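(* Let the standing setting and assumptions given in the context hold, let $\{\alpha_k\}_{k\ge 0}$ be nonnegative with $\sum_{k=0}^\infty\sqrt{\alpha_k}<\infty$, and let $\{\lambda_k\}_{k\ge1}$ be generated by the misspecified inexact augmented Lagrangian scheme (defined in the context) with constant penalty $\rho>0$ and $\lambda_0=\mathbf 0$. Let $\bar\lambda_k:=\frac1k\sum_{i=1}^k\lambda_i$ and let $\lambda^*\in\operatorname{argmax}_\lambda g_0(\lambda;\theta^* )$. Then for all $k\ge1$, $$f^*-g_\rho(\bar\lambda_k;\theta^* )=\sup_{\lambda}g_\rho(\lambda;\theta^* )-g_\rho(\bar\lambda_k;\theta^* )\le\frac{B_g}{k},$$ where $$B_g:=\frac{1}{2\rho}\|\lambda^*\|^2+C_\lambda\left(\sqrt{\tfrac{2}{\rho}}\sum_{k=0}^\infty\sqrt{\alpha_k}+\frac{M_h\|\theta_0-\theta^*\|}{1-q_\ell}\right),\qquad C_\lambda:=\sqrt{2\rho}\sum_{i=0}^\infty\sqrt{\alpha_i}+\rho M_h\frac{\|\theta_0-\theta^*\|}{1-q_\ell}+\|\lambda^*\|.$$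
   Context: Notation: $\|\cdot\|$ is the Euclidean norm; $B(0,1)$ is the closed unit ball; for a closed convex set $S$, $d_S(x)=\min_{s\in S}\|x-s\|$ and $d_S^2(x)=(d_S(x))^2$; $\mathbb R^m_+$, $\mathbb R^m_-$ are the nonnegative and nonpositive orthants. Problem. $X\subseteq\mathbb R^n$ and $\Theta\subseteq\mathbb R^d$ are convex compact sets, $f:\mathbb R^n\times\Theta\to\mathbb R\cup\{+\infty\}$, $h:\mathbb R^n\times\Theta\to\mathbb R^m$. For $\theta\in\Theta$, $\mathcal C(\theta)$ is the problem $\min\{f(x;\theta): h(x;\theta)\le 0,\ x\in X\}$. The true parameter $\theta^*\in\Theta$ is the unique minimizer over $\Theta$ of a learning objective $\ell$. $\mathcal C(\theta^* )$ has a finite optimal value $f^*$, its Lagrangian dual has a solution, and there is no duality gap. For $\rho>0$, $x\in X$, $\lambda\in\mathbb R^m$, $\theta\in\Theta$, the augmented Lagrangian is $$\mathcal L_\rho(x,\lambda;\theta)=f(x;\theta)+\tfrac{\rho}{2}d^2_{\mathbb R^m_-}\left(\tfrac{\lambda}{\rho}+h(x;\theta)\right)-\tfrac{\|\lambda\|^2}{2\rho}.$$ For $\rho=0$, $\mathcal L_0(x,\lambda;\theta)=f(x;\theta)+\lambda^\top h(x;\theta)$ if $\lambda\in\mathbb R^m_+$ and $-\infty$ otherwise. For $\rho\ge0$, $g_\rho(\lambda;\theta)=\inf_{x\in X}\mathcal L_\rho(x,\lambda;\theta)$; the Lagrangian dual of $\mathcal C(\theta)$ is $\max_\lambda g_0(\lambda;\theta)$.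 Standing assumptions: (i) $f(x;\theta)$ and each $h_j(x;\theta)$, $j=1,\dots,m$, are convex in $x\in X$ for all $\theta\in\Theta$. (ii) $|f(x;\theta_1)-f(x;\theta_2)|\le L_f\|\theta_1-\theta_2\|$ for all $x\in X$, $\theta_1,\theta_2\in\Theta$. (iii) $h(x;\theta)=A(\theta)x+b(\theta)$ with $A(\theta)\in\mathbb R^{m\times n}$, $b(\theta)\in\mathbb R^m$ Lipschitz continuous in $\theta$; $L_h$ is a constant with $\|h(x;\theta_1)-h(x;\theta_2)\|\le L_h\|\theta_1-\theta_2\|$ for all $x\in X$, $\theta_1,\theta_2\in\Theta$, and $\sigma_h$ is a constant with $h(B(0,1);\theta)\subseteq\sigma_hB(0,1)$ for all $\theta\in\Theta$. (iv) With $X^*(\lambda;\theta)=\operatorname{argmin}_{x\in X}\mathcal L_0(x,\lambda;\theta)$, there is $\kappa_X$ such that $X^*(\lambda;\theta_1)\subseteq X^*(\lambda;\theta_2)+\kappa_X\|\theta_1-\theta_2\|B(0,1)$ for all $\lambda\ge0$ and $\theta_1,\theta_2\in\Theta$. (v) $\{\theta_k\}_{k\ge0}\subset\Theta$ is a sequence with $\|\theta_k-\theta^*\|\le q_\ell^k\|\theta_0-\theta^*\|$ for all $k\ge0$, where $q_\ell\in(0,1)$. Constant $M_h$: $M_h\ge 0$ denotes a Lipschitz constant of $\nabla_\lambda g_\rho(\lambda;\cdot)$ on $\Theta$, uniform in $\lambda$, i.e. $\|\nabla_\lambda g_\rho(\lambda;\theta_1)-\nabla_\lambda g_\rho(\lambda;\theta_2)\|\le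 M_h\|\theta_1-\theta_2\|$ for all $\lambda\in\mathbb R^m$, $\theta_1,\theta_2\in\Theta$ (for $\rho>0$, $g_\rho(\cdot;\theta)$ is everywhere finite, concave and continuously differentiable). Misspecified inexact augmented Lagrangian scheme: given $\rho>0$, $\lambda_0=\mathbf 0\in\mathbb R^m$, and sequences $\{\alpha_k\}$, $\{\theta_k\}$, for each $k\ge0$: (1) choose any $x_k\in X$ with $\mathcal L_\rho(x_k,\lambda_k;\theta_k)\le g_\rho(\lambda_k;\theta_k)+\alpha_k$; (2) set $\lambda_{k+1}=\lambda_k+\rho\nabla_\lambda\mathcal L_\rho(x_k,\lambda_k;\theta_k)$. *)

(* Defs.v *)
From HB Require Import structures.
From mathcomp Require Import all_boot all_order all_algebra.
From mathcomp Require Import all_classical all_reals all_analysis.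

Set Implicit Arguments.
Unset Strict Implicit.
Unset Printing Implicit Defensive.
Import Order.TTheory GRing.Theory Num.Theory.
Import numFieldNormedType.Exports.
Local Open Scope classical_set_scope.
Local Open Scope ring_scope.

(* The library norm on matrices is the sup norm, so the Euclidean norm is
   introduced here; on a non-column matrix it is the Frobenius norm. *)
Definition enorm (R : realType) (p q : nat) (A : 'M[R]_(p, q)) : R :=
  Num.sqrt (\sum_i \sum_j A i j ^+ 2).

Definition unit_eball (R : realType) (n : nat) : set 'cV[R]_n :=
  [set x | enorm x <= 1].

Definition edist_to (R : realType) (n : nat) (S : set 'cV[R]_n) (x : 'cV[R]_n) : R :=
  inf [set enorm (x - s) | s in S].

Definition nonneg_orthant (R : realType) (m : nat) : set 'cV[R]_m :=
  [set u | forall i, 0 <= u i 0].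

Definition nonpos_orthant (R : realType) (m : nat) : set 'cV[R]_m :=
  [set u | forall i, u i 0 <= 0].

Definition argmin (disp : Order.disp_t) (T : Type) (U : porderType disp)
    (A : set T) (F : T -> U) : set T :=
  [set x | A x /\ forall y, A y -> (F x <= F y)%O].

Definition argmax (disp : Order.disp_t) (T : Type) (U : porderType disp)
    (A : set T) (F : T -> U) : set T :=
  [set x | A x /\ forall y, A y -> (F y <= F x)%O].

(* Convexity on A of a function that never takes the value -oo; the library's
   convex_function covers real-valued functions only. With 0 * +oo = 0 the
   endpoints t = 0, 1 are harmless. *)
Definition econvex_on (R : realType) (n : nat) (A : set 'cV[R]_n)
    (F : 'cV[R]_n -> \bar R) : Prop :=
  forall (x y : 'cV[R]_n) (t : R), A x -> A y -> 0 <= t <= 1 ->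
    (F ((t *: x + (1 - t) *: y)%R) <= t%:E * F x + (1 - t)%:E * F y)%E.

Definition gradient (R : realType) (m : nat) (F : 'cV[R]_m -> R)
    (u : 'cV[R]_m) : 'cV[R]_m :=
  \col_j 'D_(delta_mx j 0) F u.

Definition primal_value (R : realType) (n m d : nat) (X : set 'cV[R]_n)
    (f : 'cV[R]_n -> 'cV[R]_d -> \bar R) (h : 'cV[R]_n -> 'cV[R]_d -> 'cV[R]_m)
    (theta : 'cV[R]_d) : \bar R :=
  ereal_inf [set f x theta | x in [set x | X x /\ nonpos_orthant (h x theta)]].

(* rho = 0 is the ordinary Lagrangian, rho > 0 the augmented one. *)
Definition Lag (R : realType) (n m d : nat)
    (f : 'cV[R]_n -> 'cV[R]_d -> \bar R) (h : 'cV[R]_n -> 'cV[R]_d -> 'cV[R]_m)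
    (rho : R) (x : 'cV[R]_n) (lambda : 'cV[R]_m) (theta : 'cV[R]_d) : \bar R :=
  if rho == 0 then
    if lambda \in @nonneg_orthant R m
    then (f x theta + ((lambda^T *m h x theta) 0 0)%:E)%E
    else -oo%E
  else
    (f x theta
     + (rho / 2 * edist_to (@nonpos_orthant R m)
                           (rho^-1 *: lambda + h x theta) ^+ 2
        - enorm lambda ^+ 2 / (2 * rho))%:E)%E.

Definition dual_fun (R : realType) (n m d : nat) (X : set 'cV[R]_n)
    (f : 'cV[R]_n -> 'cV[R]_d -> \bar R) (h : 'cV[R]_n -> 'cV[R]_d -> 'cV[R]_m)
    (rho : R) (lambda : 'cV[R]_m) (theta : 'cV[R]_d) : \bar R :=
  ereal_inf [set Lag f h rho x lambda theta | x in X].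

Definition grad_Lag (R : realType) (n m d : nat)
    (f : 'cV[R]_n -> 'cV[R]_d -> \bar R) (h : 'cV[R]_n -> 'cV[R]_d -> 'cV[R]_m)
    (rho : R) (x : 'cV[R]_n) (lambda : 'cV[R]_m) (theta : 'cV[R]_d) : 'cV[R]_m :=
  gradient (fun mu => fine (Lag f h rho x mu theta)) lambda.

Definition grad_dual (R : realType) (n m d : nat) (X : set 'cV[R]_n)
    (f : 'cV[R]_n -> 'cV[R]_d -> \bar R) (h : 'cV[R]_n -> 'cV[R]_d -> 'cV[R]_m)
    (rho : R) (lambda : 'cV[R]_m) (theta : 'cV[R]_d) : 'cV[R]_m :=
  gradient (fun mu => fine (dual_fun X f h rho mu theta)) lambda.

Definition inexact_AL_scheme (R : realType) (n m d : nat) (X : set 'cV[R]_n)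
    (f : 'cV[R]_n -> 'cV[R]_d -> \bar R) (h : 'cV[R]_n -> 'cV[R]_d -> 'cV[R]_m)
    (rho : R) (alpha : nat -> R) (theta : nat -> 'cV[R]_d)
    (x : nat -> 'cV[R]_n) (lambda : nat -> 'cV[R]_m) : Prop :=
  lambda 0%N = 0 /\
  forall k, [/\ X (x k),
    (Lag f h rho (x k) (lambda k) (theta k)
       <= dual_fun X f h rho (lambda k) (theta k) + (alpha k)%:E)%E &
    lambda k.+1 = lambda k + rho *: grad_Lag f h rho (x k) (lambda k) (theta k)].

(* Main.v *)
Require Import Defs.
From HB Require Import structures.
From mathcomp Require Import all_boot all_order all_algebra.
From mathcomp Require Import all_classical all_reals all_analysis.
From mathcomp Require Import ring lra.
Set Implicit Arguments.
Unset Strict Implicit.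
Unset Printing Implicit Defensive.
Import Order.TTheory GRing.Theory Num.Theory.
Import numFieldNormedType.Exports.
Local Open Scope classical_set_scope.
Local Open Scope ring_scope.

(** The shifted dual [g_rho + |.|^2 / (2 rho)] is the partial infimum over [X]
    of a jointly convex function of the primal point and the multiplier, hence
    convex, and every near-minimizer of the augmented Lagrangian supplies an
    approximate supergradient of [g_rho].  Together these make [g_rho]
    concave and differentiable with a [1 / rho]-Lipschitz gradient, and place the
    gradient of the Lagrangian at an [alpha]-minimizer within
    [sqrt (2 alpha / rho)] of the gradient of [g_rho], without any minimax
    theorem.  The scheme is thus gradient ascent on [g_rho(., theta_star)] with
    step [rho] and summable gradient errors: exact steps are nonexpansive
    towards [lambda_star], which bounds the iterates, and the one-step value
    estimates telescope; concavity passes the bound to the averaged multiplier. *)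

(** * Euclidean inner product and norm on column vectors *)

Definition dot (R : realType) (m : nat) (u v : 'cV[R]_m) : R :=
  \sum_i u i 0 * v i 0.

Lemma dotC (R : realType) (m : nat) (u v : 'cV[R]_m) : dot u v = dot v u.
Proof. by apply: eq_bigr => i _; rewrite mulrC. Qed.

Lemma dotDl (R : realType) (m : nat) (u v w : 'cV[R]_m) :
  dot (u + v) w = dot u w + dot v w.
Proof. by rewrite -big_split; apply: eq_bigr => i _; rewrite mxE mulrDl. Qed.

Lemma dotZl (R : realType) (m : nat) (a : R) (u v : 'cV[R]_m) :
  dot (a *: u) v = a * dot u v.
Proof. by rewrite mulr_sumr; apply: eq_bigr => i _; rewrite mxE mulrA. Qed.

Lemma dotNl (R : realType) (m : nat) (u v : 'cV[R]_m) : dot (- u) v = - dot u v.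
Proof. by rewrite -scaleN1r dotZl mulN1r. Qed.

Lemma dotDr (R : realType) (m : nat) (u v w : 'cV[R]_m) :
  dot w (u + v) = dot w u + dot w v.
Proof. by rewrite !(dotC w) dotDl. Qed.

Lemma dotZr (R : realType) (m : nat) (a : R) (u v : 'cV[R]_m) :
  dot v (a *: u) = a * dot v u.
Proof. by rewrite !(dotC v) dotZl. Qed.

Lemma dotNr (R : realType) (m : nat) (u v : 'cV[R]_m) : dot v (- u) = - dot v u.
Proof. by rewrite !(dotC v) dotNl. Qed.

Definition dotE := (dotDl, dotDr, dotNl, dotNr, dotZl, dotZr).

Lemma dot_trmx (R : realType) (m : nat) (u v : 'cV[R]_m) :
  (u^T *m v) 0 0 = dot u v.
Proof. by rewrite mxE; apply: eq_bigr => i _; rewrite mxE. Qed.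

Lemma dotvv_ge0 (R : realType) (m : nat) (u : 'cV[R]_m) : 0 <= dot u u.
Proof. by apply: sumr_ge0 => i _; rewrite -expr2 sqr_ge0. Qed.

Lemma dot_suml (R : realType) (m : nat) (I : Type) (r : seq I)
    (u : I -> 'cV[R]_m) (v : 'cV[R]_m) :
  dot (\sum_(i <- r) u i) v = \sum_(i <- r) dot (u i) v.
Proof.
elim: r => [|i r IH]; last by rewrite !big_cons dotDl IH.
by rewrite !big_nil /dot big1 // => i _; rewrite mxE mul0r.
Qed.

Lemma enorm_ge0 (R : realType) (m : nat) (u : 'cV[R]_m) : 0 <= enorm u.
Proof. exact: sqrtr_ge0. Qed.

Lemma enormE (R : realType) (m : nat) (u : 'cV[R]_m) :
  enorm u = Num.sqrt (dot u u).
Proof.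
by congr Num.sqrt; apply: eq_bigr => i _; rewrite big_ord1 expr2.
Qed.

Lemma enorm_sqr (R : realType) (m : nat) (u : 'cV[R]_m) :
  enorm u ^+ 2 = dot u u.
Proof. by rewrite enormE sqr_sqrtr // dotvv_ge0. Qed.

Lemma enorm_le (R : realType) (m : nat) (u : 'cV[R]_m) (c : R) :
  0 <= c -> dot u u <= c ^+ 2 -> enorm u <= c.
Proof.
by move=> c0 uc; rewrite enormE -(ger0_norm c0) -sqrtr_sqr ler_wsqrtr.
Qed.

Lemma dot_le_enorm (R : realType) (m : nat) (u v : 'cV[R]_m) :
  dot u v <= enorm u * enorm v.
Proof.
have [a0 b0] := (enorm_ge0 u, enorm_ge0 v).
have [ha hb] := (enorm_sqr u, enorm_sqr v).
set a := enorm u in a0 ha *; set b := enorm v in b0 hb *.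
have H (s t : R) : 0 <= s ^+ 2 * a ^+ 2 + t ^+ 2 * b ^+ 2 - 2 * s * t * dot u v.
  have := dotvv_ge0 (s *: u - t *: v).
  by rewrite !dotE (dotC v u) -ha -hb; congr (_ <= _); ring.
have [az|an] := eqVneq a 0.
  rewrite az mul0r leNgt; apply/negP => D0.
  (* With [a = 0] the form [H] is linear in [s] up to a constant; this [s] would make it equal to
     [- b ^+ 2 - 2]. *)
  have := H ((b ^+ 2 + 1) / dot u v) 1.
  by rewrite az mulr1 -mulrA divfK ?gt_eqF //; nra.
have [bz|bn] := eqVneq b 0.
  rewrite bz mulr0 leNgt; apply/negP => D0.
  have := H 1 ((a ^+ 2 + 1) / dot u v).
  by rewrite bz mulr1 -mulrA divfK ?gt_eqF //; nra.
have ap : 0 < a by rewrite lt_def an.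
have bp : 0 < b by rewrite lt_def bn.
(* The weights [s = b], [t = a] equalize the two squares, so [a * b] factors out. *)
have := H b a; have ab : 0 < a * b by rewrite mulr_gt0.
have -> : b ^+ 2 * a ^+ 2 + a ^+ 2 * b ^+ 2 - 2 * b * a * dot u v
  = (a * b) * (2 * (a * b - dot u v)) by ring.
by rewrite pmulr_rge0 // pmulr_rge0 // subr_ge0.
Qed.

Lemma enormD (R : realType) (m : nat) (u v : 'cV[R]_m) :
  enorm (u + v) <= enorm u + enorm v.
Proof.
apply: enorm_le; first by rewrite addr_ge0 ?enorm_ge0.
rewrite !dotE (dotC v u) -!enorm_sqr.
have := dot_le_enorm u v; nra.
Qed.

Lemma enormZ (R : realType) (m : nat) (a : R) (u : 'cV[R]_m) :
  0 <= a -> enorm (a *: u) = a * enorm u.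
Proof.
move=> a0; rewrite !enormE !dotE mulrA sqrtrM ?mulr_ge0 //.
by rewrite -expr2 sqrtr_sqr ger0_norm.
Qed.

Lemma enormN (R : realType) (m : nat) (u : 'cV[R]_m) : enorm (- u) = enorm u.
Proof. by rewrite !enormE !dotE opprK. Qed.

Lemma sqr_entry_le_dot (R : realType) (m : nat) (u : 'cV[R]_m) (i : 'I_m) :
  u i 0 ^+ 2 <= dot u u.
Proof.
rewrite /dot (bigD1 i) //= -expr2 lerDl.
by apply: sumr_ge0 => j _; rewrite -expr2 sqr_ge0.
Qed.

Lemma dot_delta (R : realType) (m : nat) (u : 'cV[R]_m) (i : 'I_m) :
  dot u (delta_mx i 0) = u i 0.
Proof.
rewrite /dot (bigD1 i) //= !mxE !eqxx mulr1 big1 ?addr0 // => j ji.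
by rewrite mxE (negbTE ji) mulr0.
Qed.

(** * Smooth concave functions and approximate supergradients *)

(** The upper side says that [s] is a supergradient at [u], the lower side that [F] stays above a
    paraboloid of curvature [1 / rho]. Required at every [u], this packages concavity and smoothness
    in one condition. *)
Definition grad_sandwich (R : realType) (m : nat) (rho : R)
    (F : 'cV[R]_m -> R) (u s : 'cV[R]_m) : Prop :=
  forall v, F u + dot s v - dot v v / (2 * rho) <= F (u + v) <= F u + dot s v.

Lemma gradient_sandwich (R : realType) (m : nat) (rho : R)
    (F : 'cV[R]_m -> R) (u s : 'cV[R]_m) :
  0 < rho -> grad_sandwich rho F u s -> gradient F u = s.
Proof.
move=> rho0 Fs; apply/matrixP => j k; rewrite mxE (ord1 k) {k}.
apply/cvg_lim => //=.
apply/cvgrPdist_le => /= e e0; near=> t.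
have tn0 : t != 0 by near: t; exact: nbhs_dnbhs_neq.
(* Makes the quadratic error [t ^+ 2 / (2 * rho)] at most [e] times the modulus of [t]. *)
have te : `|t| <= 2 * rho * e.
  near: t; apply: dnbhs0_le; by rewrite !mulr_gt0.
set v : 'cV[R]_m := delta_mx j 0.
have := Fs (t *: v); rewrite !dotE dot_delta [dot v v]dot_delta mxE !eqxx.
rewrite [u + _]addrC /=.
set y := F (t *: v + u); set c := s j 0 => /andP[lo hi].
rewrite [_ *: _]/(t^-1 * (y - F u)).
have -> : c - t^-1 * (y - F u) = t^-1 * (F u + t * c - y) by field.
rewrite normrM normfV ler_pdivrMl ?normr_gt0 //.
rewrite ger0_norm ?subr_ge0 //.
apply: (@le_trans _ _ (t ^+ 2 / (2 * rho))).
  by rewrite expr2; lra.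
rewrite ler_pdivrMr ?mulr_gt0 // -real_normK ?num_real // expr2 -mulrA.
by rewrite ler_wpM2l // mulrC.
Unshelve. all: by end_near.
Qed.

Lemma cvgn_of_dist_le (R : realType) (K : R) (u : nat -> R) :
  0 <= K -> (forall i j, (u i - u j) ^+ 2 <= K * (i.+1%:R^-1 + j.+1%:R^-1)) ->
  cvgn u.
Proof.
move=> K0 Ku; apply/cauchy_cvgP/cauchy_exP => e e0 /=.
(* Terms beyond [N] lie within squared distance [2 * K / (N + 1)] of [u N]; the added 1 covers
   [K = 0]. *)
pose c := e ^+ 2 / (2 * K + 1).
have c0 : 0 < c by rewrite divr_gt0 ?exprn_gt0 // ltr_wpDl ?mulr_ge0.
have [N Nc] : exists N : nat, N.+1%:R^-1 < c.
  exists (Num.truncn c^-1); rewrite invf_plt ?posrE //.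
  exact: truncnS_gt.
exists (u N); exists N => //= i Ni; rewrite -ball_normE /=.
rewrite -(@ltr_pXn2r _ 2) ?nnegrE ?(ltW e0) // real_normK ?num_real //.
apply: (le_lt_trans (Ku N i)).
have : (i.+1%:R^-1 : R) <= N.+1%:R^-1 by rewrite lef_pV2 ?posrE // ler_nat.
have : 0 < (N.+1%:R^-1 : R) by rewrite invr_gt0.
move: Nc; set p := N.+1%:R^-1; set q := i.+1%:R^-1 => pc p0 qp.
have -> : e ^+ 2 = (2 * K + 1) * c.
  by rewrite /c mulrCA divff ?mulr1 // gt_eqF // ltr_wpDl ?mulr_ge0.
apply: (@le_lt_trans _ _ (2 * K * p)); first by nra.
nra.
Qed.

Definition eps_supergrad (R : realType) (m : nat) (g : 'cV[R]_m -> R)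
    (u : 'cV[R]_m) (e : R) (s : 'cV[R]_m) : Prop :=
  forall v, g (u + v) <= g u + e + dot s v.

(* Equivalently, [g + |.|^2 / (2 * rho)] is convex. *)
Definition weakly_convex (R : realType) (m : nat) (rho : R)
    (g : 'cV[R]_m -> R) : Prop :=
  forall (u w : 'cV[R]_m) (t : R), 0 <= t <= 1 ->
    g (t *: u + (1 - t) *: w)
      <= t * g u + (1 - t) * g w + t * (1 - t) * dot (u - w) (u - w) / (2 * rho).

Lemma weakly_convex_midpoint (R : realType) (m : nat) (rho : R)
    (g : 'cV[R]_m -> R) (u v : 'cV[R]_m) :
  weakly_convex rho g -> 2 * g u <= g (u + v) + g (u - v) + dot v v / rho.
Proof.
move=> wc; have h01 : 0 <= (1 / 2 : R) <= 1 by lra.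
have := wc (u + v) (u - v) (1 / 2) h01.
have -> : (1 / 2) *: (u + v) + (1 - 1 / 2) *: (u - v) = u.
  by apply/matrixP => i j; rewrite !mxE; field.
have -> : u + v - (u - v) = 2 *: v.
  by apply/matrixP => i j; rewrite !mxE; field.
rewrite !dotE; set D := dot v v.
have -> : 1 / 2 * (1 - 1 / 2) * (2 * (2 * D)) / (2 * rho) = (D / rho) / 2.
  by rewrite invfM; set r := rho^-1; field.
lra.
Qed.

(* Two approximate supergradients at a point cannot be far apart, whence an
   exact supergradient by completeness. *)
Lemma supergrad_cauchy (R : realType) (m : nat) (rho : R) (g : 'cV[R]_m -> R)
    (u s1 s2 : 'cV[R]_m) (e1 e2 : R) :
  0 < rho -> weakly_convex rho g ->
  eps_supergrad g u e1 s1 -> eps_supergrad g u e2 s2 ->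
  dot (s1 - s2) (s1 - s2) <= 4 / rho * (e1 + e2).
Proof.
move=> rho0 wc h1 h2.
have : dot s1 (s1 - s2) - dot s2 (s1 - s2) = dot (s1 - s2) (s1 - s2).
  by rewrite [RHS]dotDl dotNl.
move: (s1 - s2) => d dd.
(* Opposite displacements along [d] gain [tau * D] from the supergradients and lose
   [tau ^+ 2 * D / rho] at the midpoint; [tau = rho / 2] is the best length. *)
have := weakly_convex_midpoint u (- (rho / 2) *: d) wc.
have := h1 (- (rho / 2) *: d); have := h2 (- (- (rho / 2) *: d)).
rewrite !dotE; move: dd; set D := dot d d; move=> dd k1 k2 k3.
have : - (rho / 2) * (- (rho / 2) * D) / rho = rho / 4 * D by field; lra.
move=> E; rewrite {}E in k3.
rewrite mulrAC ler_pdivlMr //; nra.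
Qed.

(** Supergradients with errors [1 / (k + 1)] form a Cauchy sequence; their limit is an exact
    supergradient, which is the upper side. Weak convexity then yields the lower side. *)
Lemma exists_grad_sandwich (R : realType) (m : nat) (rho : R)
    (g : 'cV[R]_m -> R) (u : 'cV[R]_m) :
  0 < rho -> weakly_convex rho g ->
  (forall e, 0 < e -> exists s, eps_supergrad g u e s) ->
  exists s, grad_sandwich rho g u s.
Proof.
move=> rho0 wc hsg.
have /choice[s_ hs] : forall k : nat, exists s, eps_supergrad g u k.+1%:R^-1 s.
  by move=> k; apply: hsg; rewrite invr_gt0.
have cs i : cvgn (fun k => s_ k i 0).
  apply: (@cvgn_of_dist_le _ (4 / rho)) => [|k l]; first by rewrite divr_ge0 ?ltW.
  apply: le_trans (supergrad_cauchy rho0 wc (hs k) (hs l)).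
  by have := sqr_entry_le_dot (s_ k - s_ l) i; rewrite !mxE.
pose s : 'cV[R]_m := \col_i limn (fun k => s_ k i 0).
have up v : g (u + v) <= g u + dot s v.
  have lim1 : (fun k => g u + k.+1%:R^-1 + dot (s_ k) v) @ \oo --> g u + 0 + dot s v.
    apply: cvgD; first by apply: cvgD; [exact: cvg_cst | exact: cvg_harmonic].
    apply: cvg_big => [|i _]; first exact: add_continuous.
    by apply: cvgMr_tmp; rewrite mxE; exact: cs.
  rewrite addr0 in lim1; rewrite -(cvg_lim (@Rhausdorff R) lim1).
  apply: limr_ge; first by apply/cvg_ex; eexists; exact: lim1.
  by near=> k; exact: hs.
exists s => v; rewrite up andbT.
(* The midpoint inequality and the upper side at [u - t *: v] bound [g (u + t *: v)] from below;
   weak convexity carries this to [u + v]. The excess error [t * dot v v / (2 * rho)] vanishes with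
   [t]. *)
have key t : 0 < t <= 1 ->
    g u + dot s v - (1 - t) * (dot v v / (2 * rho)) - t * (dot v v / rho)
      <= g (u + v).
  move=> /andP[t0 t1]; have t01 : 0 <= t <= 1 by rewrite (ltW t0).
  have vE : u + v - u = v by rewrite addrAC subrr add0r.
  have := wc (u + v) u t t01; rewrite vE.
  have -> : t *: (u + v) + (1 - t) *: u = u + t *: v.
    by apply/matrixP => i j; rewrite !mxE; ring.
  have := weakly_convex_midpoint u (t *: v) wc; have := up (- (t *: v)).
  rewrite !dotE; set D := dot v v; set a := dot s v => k1 k2 k3.
  rewrite -(ler_pM2l t0).
  have {}k2 : 2 * g u <= g (u + t *: v) + g (u - t *: v) + t * (t * (D / rho)).
    by move: k2; rewrite !mulrA.
  have {}k3 : g (u + t *: v) <=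
      t * g (u + v) + (1 - t) * g u + t * ((1 - t) * (D / (2 * rho))).
    by move: k3; rewrite !mulrA.
  lra.
apply/ler_addgt0Pr => e e0.
have c0 : 0 <= dot v v / rho by rewrite divr_ge0 ?dotvv_ge0 ?ltW.
pose t := Num.min 1 (e / (dot v v / rho + 1)).
have tp : 0 < t by rewrite lt_min ltr01 divr_gt0 // ltr_wpDl.
have t01 : 0 < t <= 1 by rewrite tp ge_min lexx.
have E : dot v v / (2 * rho) = dot v v / rho / 2.
  by rewrite invfM; set r := rho^-1; field.
rewrite E; have := key t t01; rewrite E.
have : t <= e / (dot v v / rho + 1) by rewrite ge_min lexx orbT.
rewrite ler_pdivlMr ?ltr_wpDl //; set c := dot v v / rho in c0 *; lra.
Unshelve. all: by end_near.
Qed.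

(* Minimize [e + (s' - s).v + |v|^2 / (2 * rho) >= 0] over [v]. *)
Lemma eps_supergrad_enorm (R : realType) (m : nat) (rho : R)
    (g : 'cV[R]_m -> R) (u s s' : 'cV[R]_m) (e : R) :
  0 < rho -> 0 <= e -> grad_sandwich rho g u s -> eps_supergrad g u e s' ->
  enorm (s' - s) <= Num.sqrt (2 / rho) * Num.sqrt e.
Proof.
move=> rho0 e0 hs hs'; have r0 : 0 <= 2 / rho by rewrite divr_ge0 // ltW.
rewrite -sqrtrM //.
apply: enorm_le; first exact: sqrtr_ge0.
rewrite sqr_sqrtr; last exact: mulr_ge0.
have : dot s' (s' - s) - dot s (s' - s) = dot (s' - s) (s' - s).
  by rewrite [RHS]dotDl dotNl.
move: (s' - s) => d dd.
have /andP[lo _] := hs (- rho *: d); have := hs' (- rho *: d).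
move: lo dd; rewrite !dotE; set D := dot d d => lo dd hi.
have E : - rho * (- rho * D) / (2 * rho) = rho / 2 * D by field; lra.
rewrite {}E in lo; rewrite mulrAC ler_pdivlMr //; nra.
Qed.

(** * Gradient ascent with step [rho] and inexact gradients *)

(** The step raises [g] by at least [rho * dot s s / 2], while the supergradient inequality at [us]
    caps any increase by [- dot s (u - us)]. This makes the added terms in the expanded square
    nonpositive. *)
Lemma grad_step_nonexpansive (R : realType) (m : nat) (rho : R)
    (g : 'cV[R]_m -> R) (us u s : 'cV[R]_m) :
  0 < rho -> (forall v, g v <= g us) -> grad_sandwich rho g u s ->
  enorm (u + rho *: s - us) <= enorm (u - us).
Proof.
move=> rho0 gmax hs; apply: enorm_le; first exact: enorm_ge0.
have uE : u - (u - us) = us by rewrite opprB addrC subrK.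
have /andP[_] := hs (- (u - us)); have /andP[lo _] := hs (rho *: s).
rewrite enorm_sqr uE (addrAC u); move: (gmax (u + rho *: s)) lo.
move: (u - us) => w; rewrite !dotE (dotC w s); set S := dot s s => le lo hi.
have E : rho * (rho * S) / (2 * rho) = rho * S / 2 by field; lra.
rewrite {}E in lo; nra.
Qed.

(** The upper side at [us] and the lower side at [u'] combine, by an exact quadratic identity, into
    the difference of squares plus [dot e (u' - us)]; Cauchy-Schwarz bounds the latter. *)
Lemma inexact_step_gap (R : realType) (m : nat) (rho : R)
    (g : 'cV[R]_m -> R) (us u s e : 'cV[R]_m) :
  let u' := u + rho *: (s + e) in
  0 < rho -> grad_sandwich rho g u s ->
  g us - g u' <= (enorm (u - us) ^+ 2 - enorm (u' - us) ^+ 2) / (2 * rho)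
                 + enorm e * enorm (u' - us).
Proof.
move=> u' rho0 hs; rewrite {}/u'.
have := dot_le_enorm e (u + rho *: (s + e) - us).
have uE : u - (u - us) = us by rewrite opprB addrC subrK.
have /andP[_] := hs (- (u - us)); have /andP[] := hs (rho *: (s + e)).
rewrite !enorm_sqr uE [u + rho *: _ - us]addrAC.
move: (u - us) (_ * enorm _) (g _) (g us) (g _) => w q a b c.
rewrite !dotE (dotC w s) (dotC w e) (dotC e s).
move: (dot s s) (dot s e) (dot e e) (dot s w) (dot e w) (dot w w).
move=> ss se ee sw ew ww.
have E1 : rho * (rho * (ss + se) + rho * (se + ee)) / (2 * rho)
  = rho / 2 * (ss + 2 * se + ee) by field; lra.
have E2 : (ww - (ww + rho * (sw + ew)
                 + rho * (sw + rho * (ss + se) + (ew + rho * (se + ee)))))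
            / (2 * rho) = - (sw + ew) - rho / 2 * (ss + 2 * se + ee).
  by field; lra.
rewrite E1 E2; lra.
Qed.

(** Jensen's inequality from a single supergradient at the mean: the linear terms sum to zero. *)
Lemma concave_mean (R : realType) (m : nat) (rho : R) (g : 'cV[R]_m -> R)
    (lam : nat -> 'cV[R]_m) (k : nat) :
  let bar := k.+1%:R^-1 *: \sum_(0 <= i < k.+1) lam i in
  (exists s, grad_sandwich rho g bar s) ->
  \sum_(0 <= i < k.+1) g (lam i) <= k.+1%:R * g bar.
Proof.
move=> bar [s hs].
have : \sum_(0 <= i < k.+1) g (lam i)
       <= \sum_(0 <= i < k.+1) (g bar + dot (lam i - bar) s).
  apply: ler_sum => i _; have /andP[_] := hs (lam i - bar).
  by rewrite addrC subrK dotC.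
rewrite big_split /= -dot_suml sumrB !big_const_nat subn0 !iter_addr_0.
have -> : \sum_(0 <= i < k.+1) lam i - bar *+ k.+1 = 0.
  by rewrite -scaler_nat scalerA divff ?pnatr_eq0 // scale1r subrr.
by rewrite -[g bar *+ _]mulr_natl [dot 0 s]big1 ?addr0 // => i _; rewrite mxE mul0r.
Qed.

Section InexactGradientAscent.

Variables (R : realType) (m : nat) (rho : R).
Variables (g : 'cV[R]_m -> R) (G : 'cV[R]_m -> 'cV[R]_m).
Variables (us : 'cV[R]_m) (lam e : nat -> 'cV[R]_m) (eps : nat -> R) (E : R).
Hypotheses (rho0 : 0 < rho) (gG : forall u, grad_sandwich rho g u (G u)).
Hypotheses (gmax : forall u, g u <= g us) (lam0 : lam 0%N = 0).
Hypothesis lamS : forall k, lam k.+1 = lam k + rho *: (G (lam k) + e k).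
Hypothesis e_eps : forall k, enorm (e k) <= eps k.
Hypothesis eps_sum : forall k, \sum_(0 <= i < k) eps i <= E.

Lemma ascent_bounded (k : nat) : enorm (lam k - us) <= rho * E + enorm us.
Proof.
suff H : enorm (lam k - us) <= rho * (\sum_(0 <= i < k) eps i) + enorm us.
  by apply: le_trans H _; rewrite lerD2r ler_wpM2l // ltW.
elim: k => [|k IH]; first by rewrite lam0 sub0r enormN big_nil mulr0 add0r.
rewrite big_nat_recr //= mulrDr addrAC.
(* An exact, nonexpansive step followed by a perturbation of norm at most [rho * eps k]. *)
have -> : lam k.+1 - us = lam k + rho *: G (lam k) - us + rho *: e k.
  by rewrite lamS scalerDr addrA [LHS]addrAC.
apply: (le_trans (enormD _ _)); apply: lerD.
  exact: le_trans (grad_step_nonexpansive rho0 gmax (gG _)) IH.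
by rewrite enormZ ?(ltW rho0) // ler_pM2l.
Qed.

Lemma ascent_mean_gap (k : nat) :
  g us - g (k.+1%:R^-1 *: \sum_(0 <= i < k.+1) lam i.+1)
    <= (1 / (2 * rho) * enorm us ^+ 2 + (rho * E + enorm us) * E) / k.+1%:R.
Proof.
rewrite ler_pdivlMr ?ltr0n // mulrC mulrBr.
set bar := _ *: _; set C := rho * E + enorm us.
have jensen : \sum_(0 <= i < k.+1) g (lam i.+1) <= k.+1%:R * g bar.
  by apply: (@concave_mean _ _ rho); exists (G bar); exact: gG.
have E0 : 0 <= E by have := eps_sum 0; rewrite big_nil.
have C0 : 0 <= C by rewrite addr_ge0 ?enorm_ge0 ?mulr_ge0 // ltW.
(* The squared distances telescope from [lam 0 = 0], which leaves [enorm us ^+ 2]; each error is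
   weighted by the uniform bound [C] on the distance to [us]. *)
have tele j : \sum_(0 <= i < j) (g us - g (lam i.+1))
    <= (enorm us ^+ 2 - enorm (lam j - us) ^+ 2) / (2 * rho)
       + C * \sum_(0 <= i < j) eps i.
  elim: j => [|j IH].
    by rewrite !big_nil lam0 sub0r enormN subrr mul0r mulr0 addr0.
  rewrite !big_nat_recr //=.
  have := inexact_step_gap us (e j) rho0 (gG (lam j)); rewrite -lamS.
  have : enorm (e j) * enorm (lam j.+1 - us) <= C * eps j.
    by rewrite mulrC ler_pM ?enorm_ge0 ?ascent_bounded.
  move: IH; rewrite !mulrBl; lra.
have := tele k.+1; rewrite sumrB big_const_nat subn0 iter_addr_0 -[_ *+ _]mulr_natl.
have : C * \sum_(0 <= i < k.+1) eps i <= C * E by rewrite ler_wpM2l.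
have : 0 <= enorm (lam k.+1 - us) ^+ 2 / (2 * rho).
  by rewrite divr_ge0 ?sqr_ge0 // mulr_ge0 // ltW.
rewrite mulrBl mul1r (mulrC (2 * rho)^-1); lra.
Qed.

End InexactGradientAscent.

(** * The augmented penalty, coordinate by coordinate *)

Lemma edist_to_nonpos_sqr (R : realType) (m : nat) (u : 'cV[R]_m) :
  edist_to (@nonpos_orthant R m) u ^+ 2 = \sum_i Num.max (u i 0) 0 ^+ 2.
Proof.
(* The nearest point of the orthant is [u - p], with [p] the positive part of [u]. *)
pose p : 'cV[R]_m := \col_i Num.max (u i 0) 0.
have pp : dot p p = \sum_i Num.max (u i 0) 0 ^+ 2.
  by apply: eq_bigr => i _; rewrite mxE expr2.
rewrite -pp -enorm_sqr; congr (_ ^+ 2).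
have pS : [set enorm (u - s) | s in @nonpos_orthant R m] (enorm p).
  exists (u - p); last by rewrite opprB addrC subrK.
  by move=> i; rewrite !mxE subr_le0 le_max lexx.
have pmin : lbound [set enorm (u - s) | s in @nonpos_orthant R m] (enorm p).
  move=> _ [s s0 <-]; apply: enorm_le; first exact: enorm_ge0.
  rewrite enorm_sqr; apply: ler_sum => i _; rewrite !mxE.
  have si : s i 0 <= 0 by exact: s0.
  case: (leP (u i 0) 0) => ?; first by rewrite mul0r -expr2 sqr_ge0.
  by nra.
apply/eqP; rewrite eq_le; apply/andP; split.
  by apply: ge_inf => //; exists (enorm p).
by apply: lb_le_inf => //; exists (enorm p).
Qed.

Definition al_penalty (R : realType) (m : nat) (rho : R) (y l : 'cV[R]_m) : R :=
  rho / 2 * edist_to (@nonpos_orthant R m) (rho^-1 *: l + y) ^+ 2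
  - enorm l ^+ 2 / (2 * rho).

(** Stepping by [rho] along this vector gives the classical update, the positive part of
    [l + rho *: y]. *)
Definition al_grad (R : realType) (m : nat) (rho : R) (y l : 'cV[R]_m) : 'cV[R]_m :=
  \col_i Num.max (y i 0) (- (rho^-1 * l i 0)).

Definition al_penalty1 (R : realType) (rho a l : R) : R :=
  rho / 2 * (Num.max (rho^-1 * l + a) 0 ^+ 2 - (rho^-1 * l) ^+ 2).

Lemma al_penaltyE (R : realType) (m : nat) (rho : R) (y l : 'cV[R]_m) :
  0 < rho -> al_penalty rho y l = \sum_i al_penalty1 rho (y i 0) (l i 0).
Proof.
move=> rho0; rewrite /al_penalty edist_to_nonpos_sqr enorm_sqr mulr_sumr mulr_suml.
rewrite -sumrB; apply: eq_bigr => i _; rewrite !mxE /al_penalty1.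
set M := Num.max _ _; field; lra.
Qed.

Lemma al_penalty1_sandwich (R : realType) (rho a l v : R) : 0 < rho ->
  al_penalty1 rho a l + Num.max a (- (rho^-1 * l)) * v - v * v / (2 * rho)
    <= al_penalty1 rho a (l + v)
    <= al_penalty1 rho a l + Num.max a (- (rho^-1 * l)) * v.
Proof.
move=> rho0; have [w ->] : exists w, v = rho * w.
  by exists (rho^-1 * v); rewrite mulVKf // gt_eqF.
rewrite /al_penalty1 [rho^-1 * (l + _)]mulrDr mulKf ?gt_eqF //; move: (rho^-1 * l) => k.
have -> : rho * w * (rho * w) / (2 * rho) = rho * (w ^+ 2 / 2) by field; lra.
have -> : Num.max a (- k) * (rho * w) = rho * (Num.max a (- k) * w) by ring.
rewrite -!mulrA -mulrDr -mulrBr !ler_pM2l //.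
by apply/andP; split; case: (leP a (- k)) => ?;
  case: (leP (k + a) 0) => ?; case: (leP (k + w + a) 0) => ?; nra.
Qed.

(** The penalty is the maximum of the left side over [mu >= 0], attained at the positive part of
    [l + rho * a]. *)
Lemma al_penalty1_ge (R : realType) (rho a l mu : R) : 0 < rho -> 0 <= mu ->
  mu * a - (mu - l) * (mu - l) / (2 * rho) <= al_penalty1 rho a l.
Proof.
move=> rho0 mu0.
have [k lE] : exists k, l = rho * k.
  by exists (rho^-1 * l); rewrite mulVKf // gt_eqF.
have [n nE] : exists n, mu = rho * n.
  by exists (rho^-1 * mu); rewrite mulVKf // gt_eqF.
have n0 : 0 <= n by rewrite nE pmulr_rge0 in mu0.
rewrite lE nE /al_penalty1 mulKf ?gt_eqF //.
have -> : (rho * n - rho * k) * (rho * n - rho * k) / (2 * rho)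
  = rho * ((n - k) ^+ 2 / 2) by field; lra.
rewrite -!mulrA -mulrBr ler_pM2l //.
have := sqr_ge0 (n - k - a); have := sqr_ge0 n.
case: (leP (k + a) 0) => ka; last by lra.
by have := mulr_ge0_le0 n0 ka; lra.
Qed.

Lemma al_penalty1_le0 (R : realType) (rho a l : R) :
  0 < rho -> a <= 0 -> al_penalty1 rho a l <= 0.
Proof.
move=> rho0 a0; rewrite /al_penalty1 pmulr_rle0 ?divr_gt0 //.
by move: (rho^-1 * l) => k; case: (leP (k + a) 0) => ?; nra.
Qed.

(** Adding [l ^+ 2 / (2 * rho)] leaves [rho / 2] times the square of a nonnegative function convex
    in [(a, l)]; the last term is exactly the convexity defect of the added square. *)
Lemma al_penalty1_weakly_convex (R : realType) (rho a a' l l' t : R) :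
  0 < rho -> 0 <= t <= 1 ->
  al_penalty1 rho (t * a + (1 - t) * a') (t * l + (1 - t) * l')
    <= t * al_penalty1 rho a l + (1 - t) * al_penalty1 rho a' l'
       + t * (1 - t) * ((l - l') * (l - l')) / (2 * rho).
Proof.
move=> rho0 /andP[t0 t1].
have [k ->] : exists k, l = rho * k.
  by exists (rho^-1 * l); rewrite mulVKf // gt_eqF.
have [k' ->] : exists k, l' = rho * k.
  by exists (rho^-1 * l'); rewrite mulVKf // gt_eqF.
rewrite /al_penalty1.
have -> : t * (rho * k) + (1 - t) * (rho * k') = rho * (t * k + (1 - t) * k').
  by ring.
rewrite !mulKf ?gt_eqF //.
have -> : t * (1 - t) * ((rho * k - rho * k') * (rho * k - rho * k')) / (2 * rho)
  = rho / 2 * (t * (1 - t) * (k - k') ^+ 2) by field; lra.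
have -> : t * k + (1 - t) * k' + (t * a + (1 - t) * a')
  = t * (k + a) + (1 - t) * (k' + a') by ring.
move: (k + a) (k' + a') => b b'.
have r2 : 0 < rho / 2 by rewrite divr_gt0.
rewrite [t * (_ * _)]mulrCA [(1 - t) * (rho / 2 * _)]mulrCA -!mulrDr ler_pM2l //.
suff : Num.max (t * b + (1 - t) * b') 0 ^+ 2
       <= t * Num.max b 0 ^+ 2 + (1 - t) * Num.max b' 0 ^+ 2 by lra.
have cmax : Num.max (t * b + (1 - t) * b') 0
            <= t * Num.max b 0 + (1 - t) * Num.max b' 0.
  have [? ?] : b <= Num.max b 0 /\ b' <= Num.max b' 0.
    by rewrite !le_max !lexx.
  have [? ?] : 0 <= Num.max b 0 /\ 0 <= Num.max b' 0.
    by rewrite !le_max !lexx !orbT.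
  rewrite ge_max; apply/andP; split; nra.
have m0 : 0 <= Num.max (t * b + (1 - t) * b') 0 by rewrite le_max lexx orbT.
move: m0 cmax; move: (Num.max _ _) (Num.max b 0) (Num.max b' 0) => c d d' c0 cd.
apply: (@le_trans _ _ ((t * d + (1 - t) * d') ^+ 2)).
  by rewrite ler_sqr ?nnegrE // (le_trans c0).
have : 0 <= t * (1 - t) * (d - d') ^+ 2.
  by rewrite mulr_ge0 ?sqr_ge0 // mulr_ge0 // subr_ge0.
lra.
Qed.

Lemma al_penalty_sandwich (R : realType) (m : nat) (rho c : R) (y l : 'cV[R]_m) :
  0 < rho -> grad_sandwich rho (fun mu => c + al_penalty rho y mu) l (al_grad rho y l).
Proof.
move=> rho0 v; rewrite !al_penaltyE // -!addrA !lerD2l /dot.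
rewrite mulr_suml -sumrB -!big_split /=.
by apply/andP; split; apply: ler_sum => i _; rewrite !mxE;
  have /andP[lo hi] := al_penalty1_sandwich (y i 0) (l i 0) (v i 0) rho0;
  rewrite ?addrA.
Qed.

Lemma al_penalty_ge (R : realType) (m : nat) (rho : R) (y l mu : 'cV[R]_m) :
  0 < rho -> nonneg_orthant mu ->
  dot mu y - dot (mu - l) (mu - l) / (2 * rho) <= al_penalty rho y l.
Proof.
move=> rho0 mu0; rewrite al_penaltyE // /dot mulr_suml -sumrB.
by apply: ler_sum => i _; rewrite !mxE; apply: al_penalty1_ge.
Qed.

Lemma al_penalty_le0 (R : realType) (m : nat) (rho : R) (y l : 'cV[R]_m) :
  0 < rho -> nonpos_orthant y -> al_penalty rho y l <= 0.
Proof.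
move=> rho0 y0; rewrite al_penaltyE //.
by apply: sumr_le0 => i _; apply: al_penalty1_le0 => //; apply: y0.
Qed.

Lemma al_penalty_weakly_convex (R : realType) (m : nat) (rho t : R)
    (y y' l l' : 'cV[R]_m) :
  0 < rho -> 0 <= t <= 1 ->
  al_penalty rho (t *: y + (1 - t) *: y') (t *: l + (1 - t) *: l')
    <= t * al_penalty rho y l + (1 - t) * al_penalty rho y' l'
       + t * (1 - t) * dot (l - l') (l - l') / (2 * rho).
Proof.
move=> rho0 t01; rewrite !al_penaltyE // /dot !mulr_sumr mulr_suml -!big_split.
by apply: ler_sum => i _; rewrite !mxE; apply: al_penalty1_weakly_convex.
Qed.

(** * Smoothness of the augmented dual and accuracy of inexact gradients *)

Section AugmentedDual.

Variables (R : realType) (n m d : nat) (X : set 'cV[R]_n).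
Variables (f : 'cV[R]_n -> 'cV[R]_d -> \bar R).
Variables (h : 'cV[R]_n -> 'cV[R]_d -> 'cV[R]_m) (rho : R) (th : 'cV[R]_d).
Hypothesis rho0 : 0 < rho.

Lemma LagE (y : 'cV[R]_n) (l : 'cV[R]_m) :
  Lag f h rho y l th = (f y th + (al_penalty rho (h y th) l)%:E)%E.
Proof. by rewrite /Lag gt_eqF. Qed.

Lemma grad_LagE (y : 'cV[R]_n) (l : 'cV[R]_m) :
  f y th \is a fin_num -> grad_Lag f h rho y l th = al_grad rho (h y th) l.
Proof.
move=> fy; apply: (gradient_sandwich rho0).
rewrite (_ : (fun _ => _) = fun mu => fine (f y th) + al_penalty rho (h y th) mu).
  exact: al_penalty_sandwich.
by apply/funext => mu; rewrite LagE -{1}(fineK fy).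
Qed.

Let g l := dual_fun X f h rho l th.

Hypothesis f_gtNy : forall y, f y th != -oo%E.

Lemma dual_fun_le (y : 'cV[R]_n) (l : 'cV[R]_m) :
  X y -> (g l <= Lag f h rho y l th)%E.
Proof. by move=> Xy; apply: ereal_inf_lbound; exists y. Qed.

Hypothesis f_proper : exists2 y, X y & f y th \is a fin_num.
Hypothesis Lag_bounded :
  forall l, exists c, forall y, X y -> (c%:E <= Lag f h rho y l th)%E.

Lemma dual_fun_fin_num (l : 'cV[R]_m) : g l \is a fin_num.
Proof.
have [y Xy fy] := f_proper; have [c hc] := Lag_bounded l.
rewrite fin_real //; apply/andP; split.
  apply: (@lt_le_trans _ _ c%:E); first exact: ltNyr.
  by apply: le_ereal_inf_tmp => _ [z Xz <-]; exact: hc.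
apply: (le_lt_trans (dual_fun_le l Xy)).
by rewrite LagE -(fineK fy) -EFinD ltry.
Qed.

(** Rules out [f y th = +oo], where [fine] would turn the Lagrangian into the constant 0 and its
    gradient would be meaningless. *)
Lemma near_argmin_fin_num (y : 'cV[R]_n) (l : 'cV[R]_m) (e : R) :
  (Lag f h rho y l th <= g l + e%:E)%E -> f y th \is a fin_num.
Proof.
rewrite -(fineK (dual_fun_fin_num l)) -EFinD LagE.
by have := f_gtNy y; case: (f y th).
Qed.

(** With [y] fixed, the Lagrangian majorizes [g] at [l + v], is concave in the multiplier, and
    exceeds [g l] by at most [e] at [l]. *)
Lemma near_argmin_eps_supergrad (y : 'cV[R]_n) (l : 'cV[R]_m) (e : R) :
  X y -> (Lag f h rho y l th <= g l + e%:E)%E ->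
  eps_supergrad (fun mu => fine (g mu)) l e (al_grad rho (h y th) l).
Proof.
move=> Xy ye v; have fy := near_argmin_fin_num ye.
move: ye (dual_fun_le (l + v) Xy); rewrite !LagE -(fineK fy).
rewrite -(fineK (dual_fun_fin_num l)) -(fineK (dual_fun_fin_num (l + v))).
rewrite -!EFinD !lee_fin => ye /le_trans; apply.
have /andP[_ /le_trans] := al_penalty_sandwich (fine (f y th)) (h y th) l rho0 v.
by apply; rewrite lerD2r.
Qed.

Lemma exists_near_argmin (l : 'cV[R]_m) (e : R) : 0 < e ->
  exists2 y, X y & (Lag f h rho y l th <= g l + e%:E)%E.
Proof.
move=> e0; have [_ [y Xy <-] ye] := lb_ereal_inf_adherent e0 (dual_fun_fin_num l).
by exists y => //; exact: ltW.
Qed.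

Hypothesis X_convex : forall y z (t : R), X y -> X z -> 0 <= t <= 1 ->
  X (t *: y + (1 - t) *: z).
Hypothesis f_convex : econvex_on X (fun y => f y th).
Hypothesis h_affine : forall y z (t : R),
  h (t *: y + (1 - t) *: z) th = t *: h y th + (1 - t) *: h z th.

(* Partial minimization in [y] of a function jointly convex in [(y, l)]. *)
Lemma dual_fun_weakly_convex : weakly_convex rho (fun l => fine (g l)).
Proof.
move=> u w t t01; apply/ler_addgt0Pr => e e0.
have [y Xy ye] := exists_near_argmin u e0.
have [z Xz ze] := exists_near_argmin w e0.
have [fy fz] := (near_argmin_fin_num ye, near_argmin_fin_num ze).
have := dual_fun_le (t *: u + (1 - t) *: w) (X_convex Xy Xz t01).
have := f_convex Xy Xz t01; move: ye ze.
rewrite !LagE -(fineK fy) -(fineK fz) h_affine.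
rewrite -(fineK (dual_fun_fin_num u)) -(fineK (dual_fun_fin_num w)).
rewrite -(fineK (dual_fun_fin_num (t *: u + (1 - t) *: w))).
(* Convexity bounds [f] here by a finite value, so only the real case survives. *)
have := f_gtNy (t *: y + (1 - t) *: z); case: (f _ th) => [r| |] //= _.
rewrite -!EFinM -!EFinD !lee_fin.
have := al_penalty_weakly_convex (h y th) (h z th) u w rho0 t01.
have /andP[t0 t1] := t01; nra.
Qed.

Lemma dual_fun_sandwich (l : 'cV[R]_m) :
  grad_sandwich rho (fun mu => fine (g mu)) l (grad_dual X f h rho l th).
Proof.
have [e e0|s hs] := @exists_grad_sandwich _ _ _ _ l rho0 dual_fun_weakly_convex.
  have [y Xy ye] := exists_near_argmin l e0.
  by exists (al_grad rho (h y th) l); exact: near_argmin_eps_supergrad.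
by rewrite /grad_dual (gradient_sandwich rho0 hs).
Qed.

Lemma grad_Lag_near_argmin (y : 'cV[R]_n) (l : 'cV[R]_m) (e : R) :
  0 <= e -> X y -> (Lag f h rho y l th <= g l + e%:E)%E ->
  enorm (grad_Lag f h rho y l th - grad_dual X f h rho l th)
    <= Num.sqrt (2 / rho) * Num.sqrt e.
Proof.
move=> e0 Xy ye; rewrite grad_LagE; last exact: near_argmin_fin_num ye.
apply: eps_supergrad_enorm => //; first exact: dual_fun_sandwich.
exact: near_argmin_eps_supergrad.
Qed.

End AugmentedDual.

Lemma mul_sqrt_2div (R : rcfType) (rho : R) :
  0 < rho -> rho * Num.sqrt (2 / rho) = Num.sqrt (2 * rho).
Proof.
move=> rho0; rewrite -{1}(ger0_norm (ltW rho0)) -sqrtr_sqr -sqrtrM ?sqr_ge0 //.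
by congr Num.sqrt; field; lra.
Qed.

Lemma convex_set_scale (R : realType) (n : nat) (X : set 'cV[R]_n) :
  convex_set X -> forall y z (t : R), X y -> X z -> 0 <= t <= 1 ->
  X (t *: y + (1 - t) *: z).
Proof.
move=> Xc y z t /mem_set Xy /mem_set Xz /andP[t0 t1].
exact/set_mem/(Xc _ _ (Itv01 t0 t1) Xy Xz).
Qed.

(** * Comparison with the ordinary dual and the primal value *)

Lemma Lag_dual_bound (R : realType) (n m d : nat) (X : set 'cV[R]_n)
    (f : 'cV[R]_n -> 'cV[R]_d -> \bar R)
    (h : 'cV[R]_n -> 'cV[R]_d -> 'cV[R]_m) (th : 'cV[R]_d) (ls : 'cV[R]_m)
    (c : R) :
  dual_fun X f h 0 ls th = c%:E -> X !=set0 ->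
  nonneg_orthant ls /\
  forall y, X y -> (c%:E <= f y th + (dot ls (h y th))%:E)%E.
Proof.
move=> gc [y0 Xy0].
have le y : X y -> (c%:E <= Lag f h 0 y ls th)%E.
  by move=> Xy; rewrite -gc; apply: ereal_inf_lbound; exists y.
have ls0 : nonneg_orthant ls.
  by move: (le _ Xy0); rewrite /Lag eqxx; case: ifPn => [/set_mem|] //.
by split=> // y /le; rewrite /Lag eqxx mem_set // dot_trmx.
Qed.

(* [g_rho] lies above [g_0] at nonnegative multipliers and below the primal
   value everywhere, so it inherits the maximum and the maximizer of [g_0]. *)
Lemma dual_fun_le_primal (R : realType) (n m d : nat) (X : set 'cV[R]_n)
    (f : 'cV[R]_n -> 'cV[R]_d -> \bar R)
    (h : 'cV[R]_n -> 'cV[R]_d -> 'cV[R]_m) (rho : R) (th : 'cV[R]_d)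
    (l : 'cV[R]_m) :
  0 < rho -> (dual_fun X f h rho l th <= primal_value X f h th)%E.
Proof.
move=> rho0; apply: le_ereal_inf_tmp => _ [y [Xy hy] <-].
apply: le_trans (dual_fun_le _ _ _ _ _ Xy) _.
by rewrite LagE // geeDl // lee_fin al_penalty_le0.
Qed.

Lemma dual_fun_ge (R : realType) (n m d : nat) (X : set 'cV[R]_n)
    (f : 'cV[R]_n -> 'cV[R]_d -> \bar R)
    (h : 'cV[R]_n -> 'cV[R]_d -> 'cV[R]_m) (rho : R) (th : 'cV[R]_d)
    (ls : 'cV[R]_m) (c : R) :
  0 < rho -> nonneg_orthant ls ->
  (forall y, X y -> (c%:E <= f y th + (dot ls (h y th))%:E)%E) ->
  (c%:E <= dual_fun X f h rho ls th)%E.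
Proof.
move=> rho0 ls0 le; apply: le_ereal_inf_tmp => _ [y Xy <-].
apply: le_trans (le _ Xy) _; rewrite LagE // leeD2l // lee_fin.
(* Used with both multipliers equal to [ls], so the proximal term vanishes. *)
apply: le_trans (al_penalty_ge _ _ rho0 ls0).
rewrite subrr [dot 0 0]big1 ?mul0r ?subr0 // => i _.
by rewrite mxE mul0r.
Qed.

(** Carries the dual bound known at [ths] over to [th], at the cost of the variations [a] of [f] and
    [b] of [h]. The bound does not involve [y], hence [g_rho] is finite at every parameter. *)
Lemma Lag_lower_bound (R : realType) (n m d : nat)
    (f : 'cV[R]_n -> 'cV[R]_d -> \bar R)
    (h : 'cV[R]_n -> 'cV[R]_d -> 'cV[R]_m) (rho : R) (th ths : 'cV[R]_d)
    (ls l : 'cV[R]_m) (y : 'cV[R]_n) (c a b : R) :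
  0 < rho -> nonneg_orthant ls ->
  (c%:E <= f y ths + (dot ls (h y ths))%:E)%E ->
  (f y ths <= f y th + a%:E)%E -> enorm (h y ths - h y th) <= b ->
  ((c - a - enorm ls * b - dot (ls - l) (ls - l) / (2 * rho))%:E
     <= Lag f h rho y l th)%E.
Proof.
move=> rho0 ls0 lec fa hb; rewrite LagE //.
have {lec fa} := le_trans lec (leeD2r _ fa).
case: (f y th) => [r| |] //=; last by rewrite addye ?leey.
rewrite -!EFinD !lee_fin => cr.
have := al_penalty_ge (h y th) l rho0 ls0.
have : dot ls (h y ths) - dot ls (h y th) <= enorm ls * b.
  rewrite -dotNr -dotDr; apply: le_trans (dot_le_enorm _ _) _.
  by rewrite ler_wpM2l // enorm_ge0.
lra.
Qed.

(** * The rate for the averaged multipliers *)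

Theorem theorem2 (R : realType) (n m d : nat)
  (X : set 'cV[R]_n) (Theta : set 'cV[R]_d)
  (f : 'cV[R]_n -> 'cV[R]_d -> \bar R)
  (h : 'cV[R]_n -> 'cV[R]_d -> 'cV[R]_m)
  (ell : 'cV[R]_d -> R) (theta_star : 'cV[R]_d) (f_star : R)
  (L_f L_h sigma_h kappa_X q_ell M_h rho : R)
  (A : 'cV[R]_d -> 'M[R]_(m, n)) (b : 'cV[R]_d -> 'cV[R]_m)
  (theta : nat -> 'cV[R]_d) (alpha : nat -> R)
  (x : nat -> 'cV[R]_n) (lambda : nat -> 'cV[R]_m)
  (lambda_star : 'cV[R]_m)
  (* problem *)
  (X_convex : convex_set X) (X_compact : compact X)
  (Theta_convex : convex_set Theta) (Theta_compact : compact Theta)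
  (f_gtNy : forall y th, Theta th -> f y th != -oo%E)
  (theta_star_min : argmin Theta ell = [set theta_star])
  (f_star_value : primal_value X f h theta_star = f_star%:E)
  (dual_solution :
     argmax setT (fun mu => dual_fun X f h 0 mu theta_star) !=set0)
  (no_duality_gap :
     ereal_sup (range (fun mu => dual_fun X f h 0 mu theta_star)) = f_star%:E)
  (* (i) *)
  (f_convex : forall th, Theta th -> econvex_on X (fun y => f y th))
  (h_convex : forall th, Theta th -> forall j : 'I_m,
     convex_function X (fun y => h y th j 0))
  (* (ii), written additively since f may take the value +oo *)
  (f_lipschitz : forall y th1 th2, X y -> Theta th1 -> Theta th2 ->
     (f y th1 <= f y th2 + (L_f * enorm (th1 - th2))%:E)%E)
  (* (iii) *)
  (h_affine : forall y th, Theta th -> h y th = A th *m y + b th)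
  (A_lipschitz : exists L_A : R, forall th1 th2, Theta th1 -> Theta th2 ->
     enorm (A th1 - A th2) <= L_A * enorm (th1 - th2))
  (b_lipschitz : exists L_b : R, forall th1 th2, Theta th1 -> Theta th2 ->
     enorm (b th1 - b th2) <= L_b * enorm (th1 - th2))
  (h_lipschitz : forall y th1 th2, X y -> Theta th1 -> Theta th2 ->
     enorm (h y th1 - h y th2) <= L_h * enorm (th1 - th2))
  (h_ball : forall th, Theta th ->
     [set h y th | y in @unit_eball R n]
       `<=` [set sigma_h *: u | u in @unit_eball R m])
  (* (iv) *)
  (argmin_lipschitz : forall mu th1 th2,
     nonneg_orthant mu -> Theta th1 -> Theta th2 ->
     argmin X (fun y => Lag f h 0 y mu th1)
       `<=` [set y + (kappa_X * enorm (th1 - th2)) *: u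
              | y in argmin X (fun y => Lag f h 0 y mu th2)
              & u in @unit_eball R n])
  (* (v) *)
  (q_ell_itv : 0 < q_ell < 1)
  (theta_in : forall k, Theta (theta k))
  (theta_rate : forall k,
     enorm (theta k - theta_star) <= q_ell ^+ k * enorm (theta 0%N - theta_star))
  (* constant M_h *)
  (rho_gt0 : 0 < rho)
  (M_h_ge0 : 0 <= M_h)
  (grad_dual_lipschitz : forall mu th1 th2, Theta th1 -> Theta th2 ->
     enorm (grad_dual X f h rho mu th1 - grad_dual X f h rho mu th2)
       <= M_h * enorm (th1 - th2))
  (* algorithm *)
  (alpha_ge0 : forall k, 0 <= alpha k)
  (alpha_summable : cvgn (series (fun k => Num.sqrt (alpha k))))
  (scheme : inexact_AL_scheme X f h rho alpha theta x lambda)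
  (lambda_star_max :
     argmax setT (fun mu => dual_fun X f h 0 mu theta_star) lambda_star) :
  let S : R := limn (series (fun k => Num.sqrt (alpha k))) in
  let T : R := enorm (theta 0%N - theta_star) / (1 - q_ell) in
  let C_lambda : R :=
    Num.sqrt (2 * rho) * S + rho * M_h * T + enorm lambda_star in
  let B_g : R :=
    1 / (2 * rho) * enorm lambda_star ^+ 2
      + C_lambda * (Num.sqrt (2 / rho) * S + M_h * T) in
  let g (mu : 'cV[R]_m) : \bar R := dual_fun X f h rho mu theta_star in
  let lambda_bar (k : nat) : 'cV[R]_m :=
    k%:R^-1 *: \sum_(1 <= i < k.+1) lambda i in
  forall k : nat, (1 <= k)%N ->
    (f_star%:E - g (lambda_bar k) = ereal_sup (range g) - g (lambda_bar k))%E
    /\ (ereal_sup (range g) - g (lambda_bar k) <= (B_g / k%:R)%:E)%E.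
Proof.
move=> S T C_lambda B_g g lambda_bar [//|k] _.
have Ths : Theta theta_star.
  suff [] : argmin Theta ell theta_star by [].
  by rewrite theta_star_min.
have [y0 Xy0 fy0] : exists2 y, X y & f y theta_star \is a fin_num.
  have f_star_fin : primal_value X f h theta_star \is a fin_num.
    by rewrite f_star_value.
  have [_ [y [Xy _] <-]] := lb_ereal_inf_adherent (@ltr01 R) f_star_fin.
  rewrite -/(primal_value X f h theta_star) f_star_value => fy.
  exists y => //; have := f_gtNy y _ Ths.
  by move: fy; case: (f y theta_star).
have g0ls : dual_fun X f h 0 lambda_star theta_star = f_star%:E.
  rewrite -no_duality_gap; apply/le_anti/andP; split.
    by apply: ereal_sup_ubound; exists lambda_star.
  by apply: ge_ereal_sup => _ [mu _ <-]; exact: lambda_star_max.2.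
have [ls0 f_star_le] := Lag_dual_bound g0ls (ex_intro _ y0 Xy0).
(* The Lipschitz bound carries finiteness at [y0] from [theta_star] to every parameter. *)
have f_proper th : Theta th -> exists2 y, X y & f y th \is a fin_num.
  move=> Tth; exists y0 => //; have := f_lipschitz _ _ _ Xy0 Tth Ths.
  by have := f_gtNy y0 _ Tth; rewrite -(fineK fy0); case: (f y0 th).
have Lag_bounded th : Theta th -> forall l, exists c, forall y, X y ->
    (c%:E <= Lag f h rho y l th)%E.
  move=> Tth l; eexists => y Xy.
  apply: (Lag_lower_bound _ rho_gt0 ls0 (f_star_le _ Xy)).
    exact: f_lipschitz.
  exact: h_lipschitz.
have X_conv := convex_set_scale X_convex.
have h_aff th : Theta th -> forall y z (t : R),
    h (t *: y + (1 - t) *: z) th = t *: h y th + (1 - t) *: h z th.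
  move=> Tth y z t; rewrite !h_affine // mulmxDr -!scalemxAr !scalerDr addrACA.
  by rewrite -scalerDl [t + _]addrC subrK scale1r.
have fgt th : Theta th -> forall y, f y th != -oo%E by move=> ? ?; exact: f_gtNy.
have fin th l : Theta th -> dual_fun X f h rho l th \is a fin_num.
  by move=> Tth; apply: dual_fun_fin_num; [|exact: f_proper|exact: Lag_bounded].
have sandwich th l : Theta th -> grad_sandwich rho
    (fun mu => fine (dual_fun X f h rho mu th)) l (grad_dual X f h rho l th).
  move=> Tth; apply: dual_fun_sandwich => //; [exact: fgt|exact: f_proper|
    exact: Lag_bounded|exact: f_convex|exact: h_aff].
have g_le l : (g l <= f_star%:E)%E.
  by rewrite -f_star_value; exact: dual_fun_le_primal.
have gls : g lambda_star = f_star%:E.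
  by apply/le_anti; rewrite g_le; exact: dual_fun_ge.
have sup_g : ereal_sup (range g) = f_star%:E.
  apply/le_anti/andP; split; first by apply: ge_ereal_sup => _ [mu _ <-].
  by rewrite -gls; apply: ereal_sup_ubound; exists lambda_star.
rewrite sup_g; split=> //.
have [lambda0 lambdaS] := scheme.
(* Error against the gradient at the true parameter: inexact minimization contributes the [alpha]
   term of [eps], misspecification the geometric one. *)
pose e i := grad_Lag f h rho (x i) (lambda i) (theta i)
            - grad_dual X f h rho (lambda i) theta_star.
pose N0 := enorm (theta 0%N - theta_star).
pose eps i := Num.sqrt (2 / rho) * Num.sqrt (alpha i) + M_h * (N0 * q_ell ^+ i).
have e_eps i : enorm (e i) <= eps i.
  have [Xx xe _] := lambdaS i.
  have -> : e i = (grad_Lag f h rho (x i) (lambda i) (theta i)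
                   - grad_dual X f h rho (lambda i) (theta i))
                + (grad_dual X f h rho (lambda i) (theta i)
                   - grad_dual X f h rho (lambda i) theta_star).
    by rewrite addrA subrK.
  apply: le_trans (enormD _ _) _; apply: lerD.
    apply: (@grad_Lag_near_argmin _ _ _ _ X) => //; [exact: fgt|exact: f_proper|
      exact: Lag_bounded|exact: f_convex|exact: h_aff].
  apply: le_trans (grad_dual_lipschitz _ _ _ (theta_in i) Ths) _.
  by rewrite ler_wpM2l // mulrC.
pose E := Num.sqrt (2 / rho) * S + M_h * T.
have eps_sum i : \sum_(0 <= j < i) eps j <= E.
  rewrite big_split /= -!mulr_sumr; apply: lerD; apply: ler_wpM2l => //.
  - apply: (@nondecreasing_cvgn_le R (series (fun k => Num.sqrt (alpha k)))) => //.
    by apply: nondecreasing_series => j _ _; exact: sqrtr_ge0.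
  (* Partial geometric sums are at most [N0 / (1 - q_ell)], which is [T]. *)
  - have /andP[q0 q1] := q_ell_itv.
    rewrite mulr_sumr; apply: geometric_le_lim => //; first exact: enorm_ge0.
    by rewrite gtr0_norm.
(* [C_lambda] is thus the uniform bound on the distance of the iterates to [lambda_star]. *)
have C_E : C_lambda = rho * E + enorm lambda_star.
  by rewrite /C_lambda /E mulrDr !mulrA mul_sqrt_2div.
have lamS i : lambda i.+1
    = lambda i + rho *: (grad_dual X f h rho (lambda i) theta_star + e i).
  by have [_ _ ->] := lambdaS i; rewrite /e addrCA subrr addr0.
have gmax l : fine (g l) <= fine (g lambda_star).
  by rewrite gls /=; rewrite -lee_fin fineK ?g_le // fin.
have := ascent_mean_gap rho_gt0 (fun l => sandwich _ l Ths) gmax lambda0 lamS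
  e_eps eps_sum k.
have -> : k.+1%:R^-1 *: \sum_(0 <= i < k.+1) lambda i.+1 = lambda_bar k.+1.
  by rewrite /lambda_bar big_add1.
rewrite -C_E -/(g lambda_star) -/(g (lambda_bar _)) gls /=.
by rewrite -lee_fin EFinB fineK //; exact: fin.
Qed.
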